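(* Let $f:[a,b]\times\mathbb{R}\to\mathbb{R}$ be of class $C^\infty$ and Lipschitz continuous in its second variable with constant $L$, and let $u\in C^\infty[a,b]$ be the solution of $u'(t)=f(t,u(t))$ on $[a,b]$, $u(a)=u_0$. Let the real parameters $c_2,c_3,a_{21},a_{31},a_{32},w_1,w_2,w_3$ satisfy $$a_{21}=c_2,\qquad a_{31}+a_{32}=c_3,$$ $$w_1+w_2+w_3=1,\qquad 2(w_2c_2+w_3c_3)=1,\qquad 3(w_2c_2^2+w_3c_3^2)=1,\qquad 6a_{32}c_2w_3=1.$$ Suppose that the squared shape parameters $\varepsilon_{2i}^2$ and $\varepsilon_{3i}^2$, $i=0,1,\ldots,N-1$, are bounded (uniformly in $i$ and $N$). Then the MQ-RBF-based RK3 method with these parameters is convergent, i.e. $\mathbf{u}_N\to u(b)$ as $h=(b-a)/N\to0$.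
   Context: For each positive integer $N$ put $h=(b-a)/N$ and $t_i=a+ih$, $i=0,\ldots,N$. Given real numbers $\varepsilon_{2i}^2,\varepsilon_{3i}^2$ ($0\le i\le N-1$, possibly negative and possibly depending on $N$), the MQ-RBF-based RK3 method computes approximations $\mathbf{u}_i$ to $u(t_i)$ by $\mathbf{u}_0=u_0$ and $$\mathbf{u}_{i+1}=\mathbf{u}_i+h[w_1K_1+w_2K_2+w_3K_3],$$ $$K_1=f(t_i,\mathbf{u}_i),\qquad K_2=f\Big(t_i+c_2h,\ \Big(1+\tfrac{\varepsilon_{2i}^2(c_2h)^2}{2}\Big)\big(\mathbf{u}_i+ha_{21}K_1\big)\Big),$$ $$K_3=f\Big(t_i+c_3h,\ \Big(1+\tfrac{\varepsilon_{3i}^2(c_3h)^2}{2}\Big)\big(\mathbf{u}_i+h(a_{31}K_1+a_{32}K_2)\big)\Big).$$ For evaluations at times outside $[a,b]$, if any, $f$ is understood to be defined there with the same smoothness and Lipschitz property. *)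

(* Defs.v *)
From Stdlib Require Import Reals.
From Coquelicot Require Import Coquelicot.
Open Scope R_scope.

Definition Icc (a b t : R) : Prop := a <= t <= b.

(** [g] is of class C^k on [[a,b]]; [D_in] is the derivative relative to the
    interval, hence one-sided at the endpoints. *)
Fixpoint Ck_interval (k : nat) (a b : R) (g : R -> R) : Prop :=
  continuous_on (Icc a b) g /\
  match k with
  | O => True
  | S k' => exists g' : R -> R,
      (forall t, Icc a b t -> D_in g g' (Icc a b) t) /\ Ck_interval k' a b g'
  end.

Definition smooth_interval (a b : R) (g : R -> R) : Prop :=
  forall k, Ck_interval k a b g.

(** [f] is of class C^k on the closed strip [[a,b] x R]: all iterated partial
    derivatives up to order [k] exist and are jointly continuous there, those
    in the first variable being one-sided at [a] and [b]. *)
Fixpoint Ck_strip (k : nat) (a b : R) (f : R -> R -> R) : Prop :=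
  continuous_on (fun p : R * R => Icc a b (fst p))
                (fun p : R * R => f (fst p) (snd p)) /\
  match k with
  | O => True
  | S k' => exists ft fx : R -> R -> R,
      (forall t x, Icc a b t ->
         D_in (fun s => f s x) (fun s => ft s x) (Icc a b) t) /\
      (forall t x, Icc a b t -> is_derive (fun y => f t y) x (fx t x)) /\
      Ck_strip k' a b ft /\ Ck_strip k' a b fx
  end.

Definition smooth_strip (a b : R) (f : R -> R -> R) : Prop :=
  forall k, Ck_strip k a b f.

Record rk3_params : Type := RK3Params
  { c2 : R; c3 : R; a21 : R; a31 : R; a32 : R; w1 : R; w2 : R; w3 : R }.

Definition mesh (a b : R) (N : nat) : R := (b - a) / INR N.

Definition node (a b : R) (N i : nat) : R := a + INR i * mesh a b N.

(** [e2] and [e3] stand for the squared shape parameters themselves, so they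
    may be negative. *)
Definition mq_rk3_step (p : rk3_params) (f : R -> R -> R)
    (h e2 e3 t x : R) : R :=
  let K1 := f t x in
  let K2 := f (t + c2 p * h)
              ((1 + e2 * (c2 p * h) ^ 2 / 2) * (x + h * a21 p * K1)) in
  let K3 := f (t + c3 p * h)
              ((1 + e3 * (c3 p * h) ^ 2 / 2)
               * (x + h * (a31 p * K1 + a32 p * K2))) in
  x + h * (w1 p * K1 + w2 p * K2 + w3 p * K3).

(** [mq_rk3 p f a b u0 e2 e3 N i] is the approximation at the [i]-th node of
    the mesh with [N] steps; [e2 N i] and [e3 N i] are the squared shape
    parameters used in its [i]-th step. *)
Fixpoint mq_rk3 (p : rk3_params) (f : R -> R -> R) (a b u0 : R)
    (e2 e3 : nat -> nat -> R) (N i : nat) : R :=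
  match i with
  | O => u0
  | S i' => mq_rk3_step p f (mesh a b N) (e2 N i') (e3 N i') (node a b N i')
              (mq_rk3 p f a b u0 e2 e3 N i')
  end.

(* Main.v *)
(** The scheme is a perturbation of Euler's method: every stage differs from
    [f t (u t)] by at most a constant times the current error plus [h], plus
    the oscillation of [f] in its first variable over a time of order [h].
    The shape factor [1 + e (c h)^2 / 2] contributes [O(h)] because the squared
    shape parameters are bounded.  As [w1 + w2 + w3 = 1], the method is
    consistent, and a discrete Gronwall argument concludes. *)

Require Import Defs.
From Stdlib Require Import Reals Lra Lia.
From Coquelicot Require Import Coquelicot.
Open Scope R_scope.

(* Continuity relative to an interval becomes continuity on the whole line
   after composition with [clamp]. *)
Definition clamp (a b t : R) : R := Rmax a (Rmin t b).

Lemma clamp_Icc a b t : a <= b -> Icc a b (clamp a b t).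
Proof.
  intros Hab. unfold clamp, Icc, Rmax, Rmin.
  repeat destruct Rle_dec; lra.
Qed.

Lemma clamp_id a b t : Icc a b t -> clamp a b t = t.
Proof.
  unfold clamp, Icc, Rmax, Rmin. repeat destruct Rle_dec; lra.
Qed.

Lemma clamp_contracting a b s t :
  Rabs (clamp a b s - clamp a b t) <= Rabs (s - t).
Proof.
  unfold clamp, Rmax, Rmin, Rabs.
  repeat destruct Rle_dec; repeat destruct Rcase_abs; lra.
Qed.

Lemma continuity_pt_clamp a b g t :
  a <= b -> continuous_on (Icc a b) g ->
  continuity_pt (fun s => g (clamp a b s)) t.
Proof.
  intros Hab Hg. apply continuity_pt_locally. intros eps.
  destruct (proj1 (filterlim_locally _ _)
              (Hg _ (clamp_Icc a b t Hab)) eps) as [d Hd].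
  exists d. intros s Hs. apply Hd; [|now apply clamp_Icc].
  eapply Rle_lt_trans; [apply clamp_contracting|exact Hs].
Qed.

Lemma continuity_2d_pt_clamp a b (f : R -> R -> R) t x :
  a <= b ->
  continuous_on (fun q : R * R => Icc a b (fst q))
    (fun q : R * R => f (fst q) (snd q)) ->
  continuity_2d_pt (fun s y => f (clamp a b s) y) t x.
Proof.
  intros Hab Hf eps.
  destruct (proj1 (filterlim_locally _ _)
              (Hf (clamp a b t, x) (clamp_Icc a b t Hab)) eps) as [d Hd].
  exists d. intros s y Hs Hy.
  apply (Hd (clamp a b s, y)); [split|now apply clamp_Icc]; simpl.
  - eapply Rle_lt_trans; [apply clamp_contracting|exact Hs].
  - exact Hy.
Qed.

(** * Compactness: bounds and uniform continuity *)

Lemma continuous_on_Icc_bounded a b g :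
  a <= b -> continuous_on (Icc a b) g ->
  exists G, 0 <= G /\ forall t, Icc a b t -> Rabs (g t) <= G.
Proof.
  intros Hab Hg.
  destruct (continuity_ab_maj (fun s => Rabs (g (clamp a b s))) a b Hab)
    as [m [Hm _]].
  { intros t _. apply (continuity_pt_comp (fun s => g (clamp a b s)) Rabs).
    - now apply continuity_pt_clamp.
    - apply Rcontinuity_abs. }
  exists (Rabs (g (clamp a b m))). split; [apply Rabs_pos|].
  intros t Ht. specialize (Hm t Ht). cbv beta in Hm.
  now rewrite (clamp_id a b t Ht) in Hm.
Qed.

(** Heine's theorem on the compact rectangle [[a,b] x [-U,U]], applied to the clamped function. Only
    time varies here: changes of state are left to the Lipschitz bound. *)
Lemma strip_uniform_continuity a b f U eps :
  a <= b -> Ck_strip 0 a b f -> 0 < eps ->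
  exists d, 0 < d /\
    forall s t y, Icc a b s -> Icc a b t -> Rabs y <= U ->
      Rabs (s - t) < d -> Rabs (f s y - f t y) <= eps.
Proof.
  intros Hab [Hf _] He.
  destruct (uniform_continuity_2d (fun s y => f (clamp a b s) y) a b (- U) U
              (fun t x _ _ => continuity_2d_pt_clamp a b f t x Hab Hf)
              (mkposreal eps He)) as [d Hd].
  exists d. split; [apply cond_pos|].
  intros s t y Hs Ht Hy Hst.
  apply Rabs_le_between in Hy.
  rewrite <- (clamp_id a b s Hs), <- (clamp_id a b t Ht).
  apply Rlt_le. apply (Hd t y s y); auto.
  rewrite Rminus_diag, Rabs_R0. apply cond_pos.
Qed.

(** * One-sided derivatives and the mean value theorem *)

Lemma D_in_Icc_is_derive a b g g' t :
  a < t < b -> D_in g g' (Icc a b) t -> is_derive g t (g' t).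
Proof.
  intros Ht Hg. apply is_derive_Reals. intros eps He.
  destruct (Hg eps He) as [d [Hd H]]. simpl in H. unfold R_dist in H.
  assert (Hm : 0 < Rmin d (Rmin (t - a) (b - t))).
  { repeat apply Rmin_glb_lt; lra. }
  exists (mkposreal _ Hm). simpl. intros h Hh0 Hh.
  apply Rmin_Rgt in Hh. destruct Hh as [Hh1 Hh].
  apply Rmin_Rgt in Hh. destruct Hh as [Hh2 Hh3].
  apply Rabs_lt_between in Hh2, Hh3.
  replace ((g (t + h) - g t) / h)
    with ((g (t + h) - g t) / (t + h - t)) by (f_equal; ring).
  apply H. split; [split; [unfold Icc|]|]; try lra.
  now replace (t + h - t) with h by ring.
Qed.

(** The clamped function is continuous everywhere, even at [a] and [b], and coincides with [g] near
    each interior point, where it therefore has the derivative [g']. The usual mean value theorem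
    then applies to it. *)
Lemma MVT_D_in_Icc a b g g' s t :
  continuous_on (Icc a b) g ->
  (forall r, Icc a b r -> D_in g g' (Icc a b) r) ->
  a <= s -> s <= t -> t <= b ->
  exists r, s <= r <= t /\ g t - g s = g' r * (t - s).
Proof.
  intros Hc Hd Has Hst Htb.
  destruct (MVT_gen (fun r => g (clamp a b r)) s t g') as [r [Hr E]].
  - rewrite Rmin_left, Rmax_right by assumption. intros r Hr.
    apply (is_derive_ext_loc g).
    + assert (Hm : 0 < Rmin (r - a) (b - r)) by (apply Rmin_glb_lt; lra).
      exists (mkposreal _ Hm). intros q Hq. symmetry. f_equal. apply clamp_id.
      apply Rmin_Rgt in Hq. destruct Hq as [H1 H2].
      apply Rabs_lt_between in H1, H2.
      unfold minus, plus, opp in H1, H2; simpl in H1, H2. unfold Icc. lra.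
    + apply (D_in_Icc_is_derive a b); [lra|]. apply Hd. unfold Icc. lra.
  - intros r _. apply continuity_pt_clamp; [lra|assumption].
  - rewrite Rmin_left, Rmax_right in Hr by assumption.
    exists r. split; [assumption|].
    rewrite !clamp_id in E by (unfold Icc; lra). exact E.
Qed.

(** * Estimates for one stage and one step *)

(** Here [y] plays the exact value, [eta] the shape perturbation and [K] a combination of slopes.
    Each term of the expansion carries a factor [x - y] or a factor [h], and products of the two are
    absorbed by [h <= 1]. *)
Lemma Rabs_step_arg h eta x y K U D E :
  0 <= h -> h <= 1 -> 0 <= D -> 0 <= E ->
  Rabs eta <= E * h -> Rabs y <= U -> Rabs K <= D * (1 + Rabs (x - y)) ->
  Rabs ((1 + eta) * (x + h * K) - y)
    <= ((1 + E) * (1 + D) + E * U) * (Rabs (x - y) + h).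
Proof.
  intros Hh Hh1 HD HE Heta Hy HK.
  replace ((1 + eta) * (x + h * K) - y)
    with ((x - y) + eta * (x - y) + eta * y + (1 + eta) * (h * K)) by ring.
  pose proof (Rabs_pos (x - y)) as He. pose proof (Rabs_pos eta) as Het.
  pose proof (Rabs_pos y) as Hy0. pose proof (Rabs_pos K) as HK0.
  set (e := Rabs (x - y)) in *.
  assert (Heta1 : Rabs eta <= E) by nra.
  assert (H1 : Rabs (eta * (x - y)) <= E * e).
  { rewrite Rabs_mult. fold e. nra. }
  assert (H2 : Rabs (eta * y) <= E * h * U).
  { rewrite Rabs_mult. apply Rmult_le_compat; assumption. }
  assert (H3 : Rabs ((1 + eta) * (h * K)) <= (1 + E) * (h * (D * (1 + e)))).
  { rewrite !Rabs_mult, (Rabs_pos_eq h Hh).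
    apply Rmult_le_compat; [apply Rabs_pos|nra| |nra].
    eapply Rle_trans; [apply Rabs_triang|]. rewrite Rabs_R1. lra. }
  assert (H4 : h * (D * (1 + e)) <= D * (e + h)).
  { assert (h * e <= e) by nra. nra. }
  assert (H5 : (1 + E) * (h * (D * (1 + e))) <= (1 + E) * (D * (e + h))).
  { apply Rmult_le_compat_l; lra. }
  eapply Rle_trans; [apply Rabs_triang|].
  eapply Rle_trans; [apply Rplus_le_compat_r, Rabs_triang|].
  eapply Rle_trans;
    [apply Rplus_le_compat_r, Rplus_le_compat_r, Rabs_triang|].
  fold e.
  (* The term [eta * y] costs only [E * U * h], while the claim allows [E * U * (e + h)]; this is
     the slack. *)
  assert (0 <= E * U * e) by (apply Rmult_le_pos; [apply Rmult_le_pos|]; lra).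
  nra.
Qed.

(** Splitting at [f s y] separates the change of state, controlled by [L], from the change of time,
    controlled by [om]. *)
Lemma Rabs_stage (f : R -> R -> R) L s h eta x y K F U D E om :
  0 <= L -> (forall v w, Rabs (f s v - f s w) <= L * Rabs (v - w)) ->
  0 <= h -> h <= 1 -> 0 <= D -> 0 <= E ->
  Rabs eta <= E * h -> Rabs y <= U -> Rabs K <= D * (1 + Rabs (x - y)) ->
  Rabs (f s y - F) <= om ->
  Rabs (f s ((1 + eta) * (x + h * K)) - F)
    <= L * ((1 + E) * (1 + D) + E * U) * (Rabs (x - y) + h) + om.
Proof.
  intros HL Hlip Hh Hh1 HD HE Heta Hy HK Hom.
  replace (f s ((1 + eta) * (x + h * K)) - F)
    with ((f s ((1 + eta) * (x + h * K)) - f s y) + (f s y - F)) by ring.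
  eapply Rle_trans; [apply Rabs_triang|].
  apply Rplus_le_compat; [|assumption].
  eapply Rle_trans; [apply Hlip|].
  rewrite Rmult_assoc. apply Rmult_le_compat_l; [assumption|].
  now apply Rabs_step_arg.
Qed.

Lemma Rabs_shape_factor M c e h :
  0 <= h -> h <= 1 -> Rabs e <= M ->
  Rabs (e * (c * h) ^ 2 / 2) <= M * c ^ 2 * h.
Proof.
  intros Hh Hh1 He. pose proof (Rabs_pos e).
  replace (e * (c * h) ^ 2 / 2) with (e * (c ^ 2 * (h * h / 2))) by field.
  rewrite Rabs_mult, (Rabs_pos_eq (c ^ 2 * (h * h / 2))) by
    (apply Rmult_le_pos; [apply pow2_ge_0|nra]).
  rewrite Rmult_assoc.
  apply Rmult_le_compat; try assumption.
  - apply Rmult_le_pos; [apply pow2_ge_0|nra].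
  - apply Rmult_le_compat_l; [apply pow2_ge_0|nra].
Qed.

Lemma mq_rk3_step_near_euler (p : rk3_params) f L A B U G M :
  0 <= L -> 0 <= U -> 0 <= G -> 0 <= M ->
  w1 p + w2 p + w3 p = 1 ->
  (forall t x y, Icc A B t -> Rabs (f t x - f t y) <= L * Rabs (x - y)) ->
  exists C, 0 <= C /\ forall h e2 e3 t x y om,
    0 <= h -> h <= 1 -> 0 <= om -> om <= 1 ->
    Rabs e2 <= M -> Rabs e3 <= M -> Rabs y <= U -> Rabs (f t y) <= G ->
    Icc A B t -> Icc A B (t + c2 p * h) -> Icc A B (t + c3 p * h) ->
    Rabs (f (t + c2 p * h) y - f t y) <= om ->
    Rabs (f (t + c3 p * h) y - f t y) <= om ->
    Rabs (mq_rk3_step p f h e2 e3 t x - (x + h * f t y))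
      <= h * (C * (Rabs (x - y) + h + om)).
Proof.
  intros HL HU HG HM Hw Hlip.
  (* [E2], [E3] bound the shape perturbations per unit of [h]; [D2], [D3] bound the slope
     combinations entering [K2], [K3] relative to [1 + Rabs (x - y)]; [C2], [C3] are the resulting
     stage constants. The [1] in [D3] comes from [om <= 1]. *)
  set (E2 := M * c2 p ^ 2). set (E3 := M * c3 p ^ 2).
  set (D2 := Rabs (a21 p) * (G + L)).
  set (C2 := L * ((1 + E2) * (1 + D2) + E2 * U)).
  set (D3 := Rabs (a31 p) * (G + L) + Rabs (a32 p) * (G + C2 + 1)).
  set (C3 := L * ((1 + E3) * (1 + D3) + E3 * U)).
  pose proof (Rabs_pos (a21 p)). pose proof (Rabs_pos (a31 p)).
  pose proof (Rabs_pos (a32 p)). pose proof (Rabs_pos (w1 p)).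
  pose proof (Rabs_pos (w2 p)). pose proof (Rabs_pos (w3 p)).
  assert (HE2 : 0 <= E2) by (apply Rmult_le_pos; [|apply pow2_ge_0]; lra).
  assert (HE3 : 0 <= E3) by (apply Rmult_le_pos; [|apply pow2_ge_0]; lra).
  assert (HD2 : 0 <= D2) by (apply Rmult_le_pos; lra).
  assert (HC2 : 0 <= C2).
  { apply Rmult_le_pos; [lra|].
    apply Rplus_le_le_0_compat; apply Rmult_le_pos; lra. }
  assert (HD3 : 0 <= D3).
  { apply Rplus_le_le_0_compat; apply Rmult_le_pos; lra. }
  assert (HC3 : 0 <= C3).
  { apply Rmult_le_pos; [lra|].
    apply Rplus_le_le_0_compat; apply Rmult_le_pos; lra. }
  (* Each [+ 1] accounts for the term [om] of a stage shifted in time; [K1] has no shift. *)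
  exists (Rabs (w1 p) * L + Rabs (w2 p) * (C2 + 1) + Rabs (w3 p) * (C3 + 1)).
  split.
  { repeat apply Rplus_le_le_0_compat; apply Rmult_le_pos; lra. }
  intros h e2 e3 t x y om Hh Hh1 Hom Hom1 He2 He3 Hy HF Ht Ht2 Ht3 Hf2 Hf3.
  unfold mq_rk3_step. cbv zeta.
  set (K1 := f t x). rewrite (Rmult_assoc h (a21 p) K1).
  set (K2 := f (t + c2 p * h) _). set (K3 := f (t + c3 p * h) _).
  set (F := f t y) in *.
  pose proof (Rabs_pos (x - y)) as He.
  assert (HK1 : Rabs (K1 - F) <= L * Rabs (x - y)) by (apply Hlip; exact Ht).
  assert (Hdev : forall K, Rabs K <= G + Rabs (K - F)).
  { intros K. replace K with (F + (K - F)) at 1 by ring.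
    eapply Rle_trans; [apply Rabs_triang|]. lra. }
  assert (HK2 : Rabs (K2 - F) <= C2 * (Rabs (x - y) + h) + om).
  { apply Rabs_stage; try assumption.
    - intros v w. now apply Hlip.
    - now apply Rabs_shape_factor.
    - rewrite Rabs_mult. unfold D2. rewrite Rmult_assoc.
      apply Rmult_le_compat_l; [assumption|].
      pose proof (Hdev K1). nra. }
  assert (HK3 : Rabs (K3 - F) <= C3 * (Rabs (x - y) + h) + om).
  { apply Rabs_stage; try assumption.
    - intros v w. now apply Hlip.
    - now apply Rabs_shape_factor.
    - eapply Rle_trans; [apply Rabs_triang|]. rewrite !Rabs_mult.
      unfold D3. rewrite Rmult_plus_distr_r, !Rmult_assoc.
      apply Rplus_le_compat; (apply Rmult_le_compat_l; [assumption|]).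
      + pose proof (Hdev K1). nra.
      + pose proof (Hdev K2). nra. }
  (* Consistency: since the weights sum to 1, [F] can be subtracted from each stage separately. *)
  replace (x + h * (w1 p * K1 + w2 p * K2 + w3 p * K3) - (x + h * F))
    with (h * (w1 p * (K1 - F) + w2 p * (K2 - F) + w3 p * (K3 - F)))
    by (replace (w1 p) with (1 - w2 p - w3 p) by lra; ring).
  rewrite Rabs_mult, (Rabs_pos_eq h Hh).
  apply Rmult_le_compat_l; [assumption|].
  eapply Rle_trans; [apply Rabs_triang|].
  eapply Rle_trans; [apply Rplus_le_compat_r, Rabs_triang|].
  rewrite !Rabs_mult, !Rmult_plus_distr_r, !(Rmult_assoc (Rabs _)).
  repeat apply Rplus_le_compat; (apply Rmult_le_compat_l; [assumption|]); nra.
Qed.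

(** * Accumulation of errors over the mesh *)

(** The shifted error [E i + tau] grows by a factor of at most [1 + C * h <= exp (C * h)] per step,
    so the source term needs no separate geometric sum. *)
Lemma discrete_gronwall (E : nat -> R) h C tau N :
  0 <= h -> 0 <= C -> 0 <= tau -> E O = 0 ->
  (forall i, (i < N)%nat -> E (S i) <= E i + h * (C * (E i + tau))) ->
  E N <= exp (C * (INR N * h)) * tau.
Proof.
  intros Hh HC Htau E0 HE.
  assert (H : forall i, (i <= N)%nat ->
                E i + tau <= exp (C * (INR i * h)) * tau).
  { induction i as [|i IH]; intros Hi.
    - rewrite E0. simpl INR. rewrite Rmult_0_l, Rmult_0_r, exp_0. lra.
    - specialize (IH ltac:(lia)). specialize (HE i ltac:(lia)).
      rewrite S_INR.
      replace (C * ((INR i + 1) * h)) with (C * h + C * (INR i * h)) by ring.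
      rewrite exp_plus, Rmult_assoc.
      pose proof (exp_ineq1_le (C * h)).
      assert (0 <= C * h) by (apply Rmult_le_pos; assumption).
      assert (0 <= exp (C * (INR i * h)) * tau).
      { apply Rmult_le_pos; [apply Rlt_le, exp_pos|assumption]. }
      apply Rle_trans with ((1 + C * h) * (exp (C * (INR i * h)) * tau)); nra. }
  specialize (H N (le_n N)). lra.
Qed.

Lemma node_Icc a b N i : a < b -> (i <= N)%nat -> (0 < N)%nat ->
  Icc a b (node a b N i).
Proof.
  intros Hab Hi HN. unfold Icc, node, mesh.
  assert (HN' : 0 < INR N) by (now apply lt_0_INR).
  assert (Hi' : INR i <= INR N) by (now apply le_INR).
  pose proof (pos_INR i).
  assert (Hq : 0 <= INR i / INR N <= 1).
  { split; [apply Rdiv_le_0_compat; lra|].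
    apply Rmult_le_reg_r with (INR N); [lra|].
    unfold Rdiv. rewrite Rmult_assoc, Rinv_l by lra. lra. }
  replace (INR i * ((b - a) / INR N)) with ((INR i / INR N) * (b - a))
    by (field; lra).
  nra.
Qed.

Lemma node_last a b N : (0 < N)%nat -> node a b N N = b.
Proof.
  intros HN. unfold node, mesh. field.
  apply not_0_INR. lia.
Qed.

Lemma is_lim_seq_mesh a b : is_lim_seq (mesh a b) 0.
Proof.
  unfold mesh, Rdiv.
  replace (Finite 0) with (Rbar_mult (b - a) (Rbar_inv p_infty))
    by (simpl; f_equal; ring).
  apply is_lim_seq_scal_l, is_lim_seq_inv; [apply is_lim_seq_INR|easy].
Qed.

(** * Convergence of the scheme *)

Theorem theorem2 (a b : R) (hab : a < b)
  (p : rk3_params)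
  (* [A, B] contains [a, b] and all the times at which f is evaluated;
     A = a and B = b is allowed when no such time lies outside [a, b] *)
  (A B : R) (hA : A <= a) (hB : b <= B)
  (hc2 : forall N i : nat, (i < N)%nat ->
     Icc A B (node a b N i + c2 p * mesh a b N))
  (hc3 : forall N i : nat, (i < N)%nat ->
     Icc A B (node a b N i + c3 p * mesh a b N))
  (f : R -> R -> R) (hf : smooth_strip A B f)
  (L : R)
  (hL : forall t x y : R, Icc A B t ->
     Rabs (f t x - f t y) <= L * Rabs (x - y))
  (u0 : R) (u : R -> R) (hu : smooth_interval a b u)
  (hode : forall t : R, Icc a b t ->
     D_in u (fun s => f s (u s)) (Icc a b) t)
  (hu0 : u a = u0)
  (ha21 : a21 p = c2 p)
  (ha3 : a31 p + a32 p = c3 p)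
  (hord1 : w1 p + w2 p + w3 p = 1)
  (hord2 : 2 * (w2 p * c2 p + w3 p * c3 p) = 1)
  (hord3 : 3 * (w2 p * c2 p ^ 2 + w3 p * c3 p ^ 2) = 1)
  (hord4 : 6 * a32 p * c2 p * w3 p = 1)
  (e2 e3 : nat -> nat -> R)
  (he : exists M : R, forall N i : nat, (i < N)%nat ->
     Rabs (e2 N i) <= M /\ Rabs (e3 N i) <= M) :
  is_lim_seq (fun N : nat => mq_rk3 p f a b u0 e2 e3 N N) (u b).
Proof.
  destruct he as [M HM].
  assert (HM0 : 0 <= M).
  { eapply Rle_trans; [apply Rabs_pos|apply (HM 1%nat 0%nat); lia]. }
  assert (HL0 : 0 <= L).
  { pose proof (hL a 1 0 (conj hA (Rle_trans _ _ _ (Rlt_le _ _ hab) hB))) as H.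
    rewrite Rminus_0_r, Rabs_R1 in H.
    pose proof (Rabs_pos (f a 1 - f a 0)). lra. }
  assert (HAB : A <= B) by lra.
  destruct (hu O) as [Hcu _].
  destruct (continuous_on_Icc_bounded a b u ltac:(lra) Hcu)
    as [U [HU0 HU]].
  destruct (continuous_on_Icc_bounded A B (fun t => f t 0) HAB)
    as [G0 [HG0 HGb]].
  { intros t Ht. destruct (hf O) as [Hcf _].
    apply filterlim_locally. intros eps.
    destruct (proj1 (filterlim_locally _ _) (Hcf (t, 0) Ht) eps) as [d Hd].
    exists d. intros s Hs HsI. apply (Hd (s, 0)); [|exact HsI].
    split; [exact Hs|apply ball_center]. }
  (* Bound for the slope along the solution, obtained by comparing [f t (u t)] with [f t 0]. *)
  set (G := G0 + L * U).
  assert (HG : 0 <= G).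
  { apply Rplus_le_le_0_compat; [|apply Rmult_le_pos]; assumption. }
  assert (HfG : forall t, Icc a b t -> Rabs (f t (u t)) <= G).
  { intros t Ht. assert (HtA : Icc A B t) by (unfold Icc in *; lra).
    replace (f t (u t)) with (f t 0 + (f t (u t) - f t 0)) by ring.
    eapply Rle_trans; [apply Rabs_triang|].
    apply Rplus_le_compat; [now apply HGb|].
    eapply Rle_trans; [now apply hL|]. rewrite Rminus_0_r.
    apply Rmult_le_compat_l; [assumption|now apply HU]. }
  destruct (mq_rk3_step_near_euler p f L A B U G M HL0 HU0 HG HM0 hord1 hL)
    as [C [HC Hstep]].
  (* [C] comes from the numerical step; [L * G] and [1] come from the Euler defect of the exact
     solution, of size [h * (om + L * G * h)]. *)
  set (C' := C + L * G + 1).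
  assert (HLG : 0 <= L * G) by (apply Rmult_le_pos; assumption).
  set (X := exp (C' * (b - a))).
  assert (HX : 0 < X) by apply exp_pos.
  apply is_lim_seq_spec. intros eps. pose proof (cond_pos eps) as Heps.
  (* The final error bound is [X * (h + om)]. With [h <= om] it is at most [2 * X * om], so the
     factor 3 leaves a strict inequality. The cap 1 is required by the one-step estimate. *)
  set (om := Rmin 1 (eps / (3 * X))).
  assert (Hq : 0 < eps / (3 * X)) by (apply Rdiv_lt_0_compat; lra).
  assert (Hom : 0 < om) by (apply Rmin_glb_lt; lra).
  assert (Hom1 : om <= 1) by apply Rmin_l.
  assert (HomX : X * (3 * om) <= eps).
  { assert (om <= eps / (3 * X)) as Hm by apply Rmin_r.
    apply (Rmult_le_compat_l (3 * X)) in Hm; [|lra].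
    replace (3 * X * (eps / (3 * X))) with (pos eps) in Hm by (field; lra).
    lra. }
  destruct (strip_uniform_continuity A B f U om HAB (hf O) Hom)
    as [d [Hd Hunif]].
  (* Once [h * k < Rmin om d], the whole step and both stage shifts are shorter than [d], and
     [h <= om]. *)
  set (k := 1 + Rabs (c2 p) + Rabs (c3 p)).
  pose proof (Rabs_pos (c2 p)) as Hc2. pose proof (Rabs_pos (c3 p)) as Hc3.
  assert (Hk : 1 <= k) by (unfold k; lra).
  assert (Hr : 0 < Rmin om d / k).
  { apply Rdiv_lt_0_compat; [apply Rmin_glb_lt|]; lra. }
  destruct (proj2 (is_lim_seq_spec _ _) (is_lim_seq_mesh a b)
              (mkposreal _ Hr)) as [N0 HN0].
  (* The successor forces [N] to be positive, so that [mesh] does not divide by zero. *)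
  exists (S N0). intros N HN. specialize (HN0 N ltac:(lia)).
  cbv beta in HN0. simpl pos in HN0.
  assert (HNpos : (0 < N)%nat) by lia.
  assert (HNR : 0 < INR N) by now apply lt_0_INR.
  set (h := mesh a b N) in *.
  assert (Hh : 0 < h) by (apply Rdiv_lt_0_compat; lra).
  rewrite Rminus_0_r, Rabs_pos_eq in HN0 by lra.
  assert (Hhk : h * k < Rmin om d).
  { apply (Rmult_lt_compat_r k) in HN0; [|lra].
    replace (Rmin om d / k * k) with (Rmin om d) in HN0 by (field; lra).
    exact HN0. }
  apply Rmin_Rgt in Hhk. destruct Hhk as [Hhom Hhd].
  assert (Hh_om : h <= om) by nra.
  assert (Hh_d : h < d) by nra.
  assert (Hc2d : Rabs (c2 p) * h < d) by (unfold k in *; nra).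
  assert (Hc3d : Rabs (c3 p) * h < d) by (unfold k in *; nra).
  set (v := mq_rk3 p f a b u0 e2 e3 N).
  assert (Hgr : Rabs (v N - u (node a b N N))
                <= exp (C' * (INR N * h)) * (h + om)).
  { apply (discrete_gronwall (fun i => Rabs (v i - u (node a b N i))));
      [lra|unfold C'; lra|lra| |].
    - unfold v, node; simpl. rewrite Rmult_0_l, Rplus_0_r, hu0, Rminus_diag.
      apply Rabs_R0.
    - intros i Hi.
      assert (Ht : Icc a b (node a b N i)) by (apply node_Icc; [lra|lia|lia]).
      assert (Ht' : Icc a b (node a b N (S i)))
        by (apply node_Icc; [lra|lia|lia]).
      assert (Es : node a b N (S i) = node a b N i + h).
      { unfold node. rewrite S_INR. fold h. ring. }
      specialize (hc2 N i Hi). specialize (hc3 N i Hi).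
      destruct (HM N i Hi) as [He2 He3]. fold h in hc2, hc3.
      rewrite Es in *. set (t := node a b N i) in *.
      assert (HtA : Icc A B t) by (unfold Icc in *; lra).
      assert (Hosc : forall s r, Icc A B s -> Icc a b r -> Rabs (s - t) < d ->
                Rabs (f s (u r) - f t (u r)) <= om).
      { intros s r Hs Hr'. apply Hunif; auto. }
      assert (Hv : Rabs (v (S i) - (v i + h * f t (u t)))
                   <= h * (C * (Rabs (v i - u t) + h + om))).
      { unfold v at 1; simpl. fold h v. fold t.
        apply Hstep; auto; try lra; apply Hosc; auto;
          rewrite Rplus_minus_l, Rabs_mult, (Rabs_pos_eq h); lra. }
      (* The increment of [u] is [h] times the slope at some [r] in the step. Splitting at
         [f r (u t)] leaves an oscillation in time, at most [om], and a change of state; a second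
         mean value argument bounds [u r - u t] by [G * h]. *)
      assert (Hu' : Rabs (u (t + h) - u t - h * f t (u t))
                    <= h * (om + L * G * h)).
      { destruct (MVT_D_in_Icc a b u _ t (t + h) Hcu hode) as [r [Hr1 Hr2]];
          try (unfold Icc in *; lra).
        destruct (MVT_D_in_Icc a b u _ t r Hcu hode) as [q [Hq1 Hq2]];
          try (unfold Icc in *; lra).
        cbv beta in Hr2, Hq2.
        rewrite Hr2.
        replace (f r (u r) * (t + h - t) - h * f t (u t))
          with (h * ((f r (u t) - f t (u t)) + (f r (u r) - f r (u t))))
          by ring.
        assert (HrA : Icc A B r) by (unfold Icc in *; lra).
        rewrite Rabs_mult, (Rabs_pos_eq h) by lra.
        apply Rmult_le_compat_l; [lra|].
        eapply Rle_trans; [apply Rabs_triang|]. apply Rplus_le_compat.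
        - apply Hosc; auto. apply Rabs_lt_between. lra.
        - eapply Rle_trans; [now apply hL|].
          rewrite Rmult_assoc. apply Rmult_le_compat_l; [assumption|].
          rewrite Hq2, Rabs_mult, (Rabs_pos_eq (r - t)) by lra.
          apply Rmult_le_compat; try apply Rabs_pos; try lra.
          apply HfG. unfold Icc in *; lra. }
      (* Both increments are compared with the same [h * f t (u t)], so the old error is carried
         over with coefficient exactly 1. *)
      replace (v (S i) - u (t + h))
        with ((v i - u t) + (v (S i) - (v i + h * f t (u t)))
              - (u (t + h) - u t - h * f t (u t))) by ring.
      eapply Rle_trans; [apply Rabs_triang|]. rewrite Rabs_Ropp.
      eapply Rle_trans; [apply Rplus_le_compat_r, Rabs_triang|].
      pose proof (Rabs_pos (v i - u t)) as Hpos.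
      set (e := Rabs (v i - u t)) in *.
      assert (Hsum : C * (e + h + om) + (om + L * G * h)
                     <= C' * (e + (h + om))) by (unfold C'; nra).
      apply (Rmult_le_compat_l h) in Hsum; [|lra].
      lra. }
  rewrite node_last in Hgr by assumption.
  (* The Gronwall factor thus equals [X], which does not depend on [N]. *)
  replace (INR N * h) with (b - a) in Hgr by (unfold h, mesh; field; lra).
  fold X in Hgr.
  eapply Rle_lt_trans; [exact Hgr|].
  nra.
Qed.
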